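(* For all integers $n\geq 1$ and $0\leq k\leq n-1$, $$Q_{n,k}(x,t)=\sum_{T\in \mathcal O_{n+1,k}}x^{\mathrm{young}_T(1)-1}\,t^{\mathrm{eld}(T)}.$$
   Context: Define polynomials $Q_n(x,y,z,t)$ by $Q_1=1$ and $Q_{n+1}=[x+nz+(y+t)(n+y\partial_y)]Q_n$ for $n\ge1$, and define $Q_{n,k}(x,t)$ by $Q_n(x,y,1,t)=\sum_{k=0}^{n-1}Q_{n,k}(x,t)y^k$. All trees are rooted trees whose vertices are labeled by distinct positive integers. A vertex $j$ is a descendant of $i$ if the path from the root to $j$ passes through $i$ (every vertex is a descendant of itself); $\beta_T(i)$ is the smallest descendant of $i$ in $T$. If $j$ is a descendant of $i$ joined to $i$ by an edge, $j$ is a child of $i$ and the edge is written $(i,j)$; two children of the same vertex are brothers. A plane tree is a rooted tree in which the children of each vertex are linearly ordered (left to right). In a plane tree $T$, a vertex $j$ is elder if it has a brother $k$ to its right with $\beta_T(k)<\beta_T(j)$; otherwise $j$ is younger. $\mathrm{eld}_T(v)$ is the number of elder children of $v$, $\mathrm{eld}(T)$ is the total number of elder vertices of $T$, $\deg_T(v)$ is the number of children of $v$, and $\mathrm{young}_T(v)=\deg_T(v)-\mathrm{eld}_T(v)$. An edge $(i,j)$ is proper if $j$ is an elder child of $i$ or $i<\beta_T(j)$; otherwise it is improper. $\mathcal O_{m,k}$ denotes the set of plane trees on vertex set $[m]=\{1,\dots,m\}$ with root $1$ having exactly $k$ improper edges. *)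

(* Defs.v *)
From HB Require Import structures.
From mathcomp Require Import all_boot all_order all_algebra.
From Stdlib Require List.
Set Implicit Arguments. Unset Strict Implicit. Unset Printing Implicit Defensive.
Import GRing.Theory.
Local Open Scope ring_scope.

(* The polynomials Q_n(x,y,z,t), with integer coefficients, as nested  *)
(* univariate polynomials: Z[x,y,z,t] = ((Z[t])[x])[z])[y].            *)

Definition PXT := {poly {poly int}}.
Definition xv : PXT := 'X.
Definition tv : PXT := ('X : {poly int})%:P.

Definition PXYZT := {poly {poly PXT}}.
Definition X4 : PXYZT := (xv%:P)%:P.
Definition Y4 : PXYZT := 'X.
Definition Z4 : PXYZT := ('X : {poly PXT})%:P.
Definition T4 : PXYZT := (tv%:P)%:P.

Definition Qstep (n : nat) (p : PXYZT) : PXYZT :=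
  (X4 + n%:R * Z4) * p + (Y4 + T4) * (n%:R * p + Y4 * deriv p).

(* Q n is Q_n for n >= 1 : Q_1 = 1, Q_{n+1} = Qstep n Q_n.
   (Q 0 is an unused dummy value.) *)
Fixpoint Q (n : nat) : PXYZT :=
  match n with
  | 0 => 1
  | m.+1 => if m is 0 then 1 else Qstep m (Q m)
  end.

Definition Qz1 (n : nat) : {poly PXT} :=
  map_poly (fun q : {poly PXT} => q.[1]) (Q n).

Definition Qnk (n k : nat) : PXT := (Qz1 n)`_k.

Inductive ptree : Type := Node : nat -> seq ptree -> ptree.

Definition label (T : ptree) : nat := let: Node v _ := T in v.
Definition children (T : ptree) : seq ptree := let: Node _ cs := T in cs.

Fixpoint labels (T : ptree) : seq nat :=
  let: Node v cs := T in v :: flatten (map labels cs).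

Fixpoint beta (T : ptree) : nat :=
  let: Node v cs := T in foldr minn v (map beta cs).

Fixpoint elders (cs : seq ptree) : seq bool :=
  match cs with
  | [::] => [::]
  | c :: cs' => has (fun d => (beta d < beta c)%N) cs' :: elders cs'
  end.

Definition eld_root (T : ptree) : nat := count id (elders (children T)).
Definition deg_root (T : ptree) : nat := size (children T).
Definition young_root (T : ptree) : nat := (deg_root T - eld_root T)%N.

Fixpoint eld (T : ptree) : nat :=
  let: Node v cs := T in (count id (elders cs) + sumn (map eld cs))%N.

Fixpoint improper (T : ptree) : nat :=
  let: Node v cs := T in
  (count id [seq ~~ (e.1 || (v < beta e.2)%N) | e <- zip (elders cs) cs]
   + sumn (map improper cs))%N.

Definition inO (m k : nat) (T : ptree) : Prop :=
  [/\ label T = 1%N, perm_eq (labels T) (iota 1 m) & improper T = k].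

Definition weight (T : ptree) : PXT := xv ^+ (young_root T - 1) * tv ^+ eld T.

Definition enumO (m k : nat) (s : seq ptree) : Prop :=
  List.NoDup s /\ (forall T, List.In T s <-> inO m k T).

(* Main.v *)
Require Import Defs.
From HB Require Import structures.
From mathcomp Require Import all_boot all_order all_algebra.
From mathcomp Require Import zify ring.
Set Implicit Arguments. Unset Strict Implicit. Unset Printing Implicit Defensive.
Import GRing.Theory.
Local Open Scope ring_scope.

(* A plane tree on [M] arises in exactly one way from a tree T on [M - 1], by
   one of the following insertions of M.
   - M becomes a leaf.  It is elder (factor t) unless it is the rightmost child
     of its parent, in which case it only adds a factor x when that parent is
     the root.
   - M subdivides an edge: the edge below M is improper (factor y).
   - An improper edge (i,j) is chosen, where i has children l ++ j :: r.  The
     subtree at i is replaced by a subtree at M whose children are either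
     l ++ [j; i'] (i' is improper, factor y) or l ++ [i'; j] (i' is elder,
     factor t), where i' is the vertex i with children r.  As j is younger and
     beta(j) < i, one has beta(j) < beta(i'), which makes the two cases
     distinguishable and keeps the status of every other edge.
   With n + 1 vertices and k improper edges in T, the factors add up to
   x + n(1 + t + y) + k(t + y), which is the recurrence of Q at z = 1. *)

(** * Decidable equality and induction for plane trees *)

(** Serves to transport decidable equality from [GenTree.tree]. Its image contains no
    [GenTree.Leaf], so the value of [of_gentree] there is arbitrary. *)
Fixpoint gentree_of (T : ptree) : GenTree.tree nat :=
  let: Node v cs := T in GenTree.Node v (map gentree_of cs).

Fixpoint of_gentree (G : GenTree.tree nat) : ptree :=
  match G with
  | GenTree.Leaf v => Node v [::]
  | GenTree.Node v Gs => Node v (map of_gentree Gs)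
  end.

Lemma gentree_ofK : cancel gentree_of of_gentree.
Proof.
rewrite /cancel; fix IH 1 => -[v cs] /=; congr Node.
by elim: cs => //= c cs ->; rewrite IH.
Qed.

HB.instance Definition _ := Equality.copy ptree (can_type gentree_ofK).

Lemma ptree_induction (P : ptree -> Prop) :
  (forall v cs, (forall c, c \in cs -> P c) -> P (Node v cs)) -> forall T, P T.
Proof.
move=> IHP; fix IH 1 => -[v cs]; apply: IHP.
(* [IH] is cleared so that [by] cannot apply it to a tree that is not a subterm, which would break
   the guard condition. *)
elim: cs => [|c cs IHcs] d; first by clear IH.
rewrite inE => /predU1P[->|]; [exact: IH | exact: IHcs].
Qed.

Lemma List_InP (T : eqType) (x : T) (s : seq T) : List.In x s <-> x \in s.
Proof.
elim: s => [|a s IHs] //=; rewrite inE; split.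
  by move=> [->|/IHs ->]; rewrite ?eqxx ?orbT.
by move=> /predU1P[->|/IHs]; [left | right].
Qed.

Lemma List_NoDupP (T : eqType) (s : seq T) : List.NoDup s <-> uniq s.
Proof.
elim: s => [|a s IHs] /=; first by split=> // _; constructor.
split=> [H|/andP[/negP Ha Hs]].
  inversion H as [|b r Hb Hr]; subst.
  by apply/andP; split; [apply/negP => /List_InP | apply/IHs].
by constructor; [move/List_InP | apply/IHs].
Qed.

(** * Smallest labels *)

Lemma beta_mem T : beta T \in labels T.
Proof.
elim/ptree_induction: T => v cs IH /=.
elim: cs IH => [|c cs IHcs] IH /=; first by rewrite mem_head.
rewrite inE mem_cat /minn; case: ifP => _.
  by rewrite IH ?mem_head ?orbT.
have := IHcs (fun d Hd => IH d (mem_behead (s := c :: cs) Hd)).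
by rewrite inE => /predU1P[->|->]; rewrite ?eqxx ?orbT.
Qed.

Lemma beta_le T a : a \in labels T -> (beta T <= a)%N.
Proof.
elim/ptree_induction: T a => v cs IH a /=.
elim: cs IH => [|c cs IHcs] IH /=; first by rewrite inE => /eqP->.
have IH' := IHcs (fun d Hd => IH d (mem_behead (s := c :: cs) Hd)).
rewrite inE mem_cat geq_min => H; case/or3P: H => H.
- by rewrite IH' ?orbT // inE H.
- by rewrite IH ?mem_head.
- by rewrite IH' ?orbT // inE H orbT.
Qed.

Lemma beta_eq T b :
  b \in labels T -> {in labels T, forall a, (b <= a)%N} -> beta T = b.
Proof.
move=> bT bmin; apply/eqP; rewrite eqn_leq beta_le //=.
exact/bmin/beta_mem.
Qed.


(** * Lists of the insertions of a new largest label *)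

Fixpoint insertions (A : Type) (x : A) (s : seq A) : seq (seq A) :=
  if s is a :: s' then (x :: s) :: [seq a :: r | r <- insertions x s']
  else [:: [:: x]].

(** The local [fix] keeps [f] outside the recursion, so that [inner] may call itself inside [f] and
    still pass the guard check. *)
Definition replacements (A : Type) (f : A -> seq A) : seq A -> seq (seq A) :=
  fix repl s := if s is a :: s' then
    [seq b :: s' | b <- f a] ++ [seq a :: r | r <- repl s'] else [::].

Definition improper_edge (i : nat) (j : ptree) (r : seq ptree) : bool :=
  ~~ has (fun d => (beta d < beta j)%N) r && (beta j <= i)%N.

(* [cs] are the children of i that remain to be scanned, [l] those already
   passed: one pair of trees for each improper edge (i,j) with j in [cs]. *)
Fixpoint splits (M i : nat) (l cs : seq ptree) : seq ptree :=
  if cs is j :: r then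
    (if improper_edge i j r then
      [:: Node M (l ++ [:: j; Node i r]); Node M (l ++ [:: Node i r; j])]
     else [::]) ++ splits M i (rcons l j) r
  else [::].

(** The root of [T] stays the root. Inside a child, [M] may also become the root, which is [outer],
    unfolded here because of the recursion. *)
Fixpoint inner (M : nat) (T : ptree) : seq ptree :=
  let: Node v cs := T in
  map (Node v) (insertions (Node M [::]) cs ++
    replacements (fun c => Node M [:: c] ::
      splits M (label c) [::] (children c) ++ inner M c) cs).

Definition outer (M : nat) (T : ptree) : seq ptree :=
  Node M [:: T] :: splits M (label T) [::] (children T) ++ inner M T.

Lemma innerE M v cs :
  inner M (Node v cs) = map (Node v)
    (insertions (Node M [::]) cs ++ replacements (outer M) cs).
Proof. by []. Qed.

Lemma insertionsP (A : eqType) (x : A) s r :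
  reflect (exists s1 s2, s = s1 ++ s2 /\ r = s1 ++ x :: s2)
    (r \in insertions x s).
Proof.
apply: (iffP idP) => [|[s1 [s2 [-> ->]]]].
  elim: s r => [|a s IHs] r /=; rewrite inE.
    by move=> /eqP->; exists [::], [::].
  move=> /predU1P[->|/mapP[q /IHs[s1 [s2 [-> ->]]] ->]].
    by exists [::], (a :: s).
  by exists (a :: s1), s2.
elim: s1 => [|a s1 IHs] /=; first by case: s2 => [|b s2]; rewrite mem_head.
by rewrite inE; apply/orP; right; apply/mapP; exists (s1 ++ x :: s2).
Qed.

Lemma replacementsP (A : eqType) (f : A -> seq A) s r :
  reflect (exists s1 a b s2, [/\ s = s1 ++ a :: s2, b \in f a &
      r = s1 ++ b :: s2])
    (r \in replacements f s).
Proof.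
apply: (iffP idP) => [|[s1 [a [b [s2 [-> Hb ->]]]]]].
  elim: s r => [|a s IHs] r //=; rewrite mem_cat.
  case/orP=> /mapP[q]; first by move=> Hq ->; exists [::], a, q, s.
  by move=> /IHs[s1 [c [b [s2 [-> Hb ->]]]]] ->; exists (a :: s1), c, b, s2.
elim: s1 => [|c s1 IHs] /=; rewrite mem_cat.
  by rewrite map_f.
by rewrite [X in _ || X]map_f ?orbT.
Qed.

Lemma splitsP M i l cs T :
  reflect (exists l' j r, [/\ cs = l' ++ j :: r, improper_edge i j r &
      T \in [:: Node M (l ++ l' ++ [:: j; Node i r]);
                Node M (l ++ l' ++ [:: Node i r; j])]])
    (T \in splits M i l cs).
Proof.
apply: (iffP idP) => [|[l' [j [r [-> Hj HT]]]]].
  elim: cs l => [|j r IHr] l //=; rewrite mem_cat => /orP[|].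
    by case: ifP => // Hj HT; exists [::], j, r.
  move=> /IHr[l' [k [q [-> Hk HT]]]]; exists (j :: l'), k, q; split=> //.
  by rewrite !cat_rcons in HT.
elim: l' l HT => [|c l' IHl] l HT /=; rewrite mem_cat.
  by rewrite Hj HT.
by rewrite IHl ?orbT // !cat_rcons.
Qed.

(** * Labels after an insertion *)

Definition forest_labels (cs : seq ptree) := flatten (map labels cs).

Lemma labelsE v cs : labels (Node v cs) = v :: forest_labels cs.
Proof. by []. Qed.

Lemma forest_labels_cat s1 s2 :
  forest_labels (s1 ++ s2) = forest_labels s1 ++ forest_labels s2.
Proof. by rewrite /forest_labels map_cat flatten_cat. Qed.

Lemma forest_labels_cons c s :
  forest_labels (c :: s) = labels c ++ forest_labels s.
Proof. by []. Qed.

Lemma child_labels v cs c : c \in cs -> {subset labels c <= labels (Node v cs)}.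
Proof.
move=> Hc a Ha; rewrite labelsE inE.
by apply/orP/or_intror/flatten_mapP; exists c.
Qed.

Lemma child_labels_uniq v cs c :
  c \in cs -> uniq (labels (Node v cs)) -> uniq (labels c).
Proof.
case/splitPr => s1 s2; rewrite labelsE forest_labels_cat forest_labels_cons /=.
by rewrite !cat_uniq => /and4P[_ _ _ /andP[]].
Qed.

Lemma splits_labels M i cs T :
  T \in splits M i [::] cs -> perm_eq (labels T) (M :: i :: forest_labels cs).
Proof.
move=> /splitsP[l [j [r [-> _]]]]; rewrite !inE /=.
case/orP=> /eqP ->; rewrite labelsE perm_cons !forest_labels_cat
  !forest_labels_cons /= cats0; apply/permP => a; rewrite /= !count_cat /= ?count_cat /=.
all: rewrite -/(forest_labels _); lia.
Qed.

Lemma inner_labels M T T' :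
  T' \in inner M T -> perm_eq (labels T') (M :: labels T).
Proof.
elim/ptree_induction: T T' => v cs IH T'.
rewrite innerE => /mapP[ds]; rewrite mem_cat => /orP[].
  move=> /insertionsP[s1 [s2 [-> ->]]] ->.
  rewrite !labelsE !forest_labels_cat forest_labels_cons /=.
  by apply/permP => a; rewrite /= !count_cat /= ; lia.
move=> /replacementsP[s1 [c [d [s2 [Ecs Hd ->]]]]] ->.
suff Hp : perm_eq (labels d) (M :: labels c).
  rewrite Ecs !labelsE !forest_labels_cat !forest_labels_cons /=.
  by move/permP: Hp => Hp; apply/permP => a; rewrite /= !count_cat Hp /=; lia.
move: Hd; rewrite inE mem_cat => /or3P[/eqP->||].
- by rewrite /= cats0.
- by move=> /splits_labels; case: (c).
- by apply: IH; rewrite Ecs mem_cat mem_head orbT.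
Qed.

Lemma outer_labels M T T' :
  T' \in outer M T -> perm_eq (labels T') (M :: labels T).
Proof.
rewrite inE mem_cat => /or3P[/eqP->||].
- by rewrite /= cats0.
- by move=> /splits_labels; case: (T).
- exact: inner_labels.
Qed.

Lemma inner_label M T T' : T' \in inner M T -> label T' = label T.
Proof. by case: T => v cs; rewrite innerE => /mapP[ds _ ->]. Qed.

(** A new largest label is never the minimum. Hence an insertion inside a child does not affect the
    edges around that child. *)
Lemma outer_beta M T T' : {in labels T, forall a, (a < M)%N} ->
  T' \in outer M T -> beta T' = beta T.
Proof.
move=> HM /outer_labels/perm_mem HT'; apply: beta_eq.
  by rewrite HT' inE beta_mem orbT.
move=> a; rewrite HT' inE => /predU1P[->|/beta_le//].
exact/ltnW/HM/beta_mem.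
Qed.

Lemma improper_edge_lt i j r :
  uniq (labels (Node i (j :: r))) -> improper_edge i j r ->
  (beta j < beta (Node i r))%N.
Proof.
have : beta (Node i r) \in i :: forest_labels r := beta_mem _.
move: (beta _) => b Hb.
rewrite labelsE forest_labels_cons /= => /andP[Hi Hu] /andP[Hr Hji].
have Hj := beta_mem j.
(* The minimum of [Node i r] is [i] or lies in a right brother of [j]; distinctness of labels makes
   both comparisons strict. *)
move: Hb Hu; rewrite inE cat_uniq => /predU1P[->|Hb] /and3P[_ Hd _].
  rewrite ltn_neqAle Hji andbT; apply: contraNneq Hi => <-.
  by rewrite mem_cat Hj.
have /flatten_mapP[d Hdr Hbd] := Hb.
have /beta_le Hdb := Hbd.
rewrite ltn_neqAle; apply/andP; split.
  by apply: contraNneq Hd => E; apply/hasP; exists b; rewrite // -E.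
apply: leq_trans Hdb; rewrite leqNgt; apply: contra Hr => Hlt.
by apply/hasP; exists d.
Qed.

(** * Each tree arises from exactly one smaller tree *)

Lemma insertion_exists M T : M \in labels T ->
  if label T == M then T = Node M [::] \/ exists T0, T \in outer M T0
  else exists T0, T \in inner M T0.
Proof.
elim/ptree_induction: T => v cs IH; rewrite [label _]/=.
case: eqVneq => [-> _|vM].
  case/lastP: cs {IH} => [|cs b]; first by left.
  right; case/lastP: cs => [|l a].
    by exists b; rewrite mem_head.
  rewrite -cats1 cat_rcons.
  (* Of the last two children of [M], the one with the smaller minimum is taken as [j], the other as
     [i] with the children [r]. *)
  case Hab: (beta a < beta b)%N.
  - case: b Hab => i r Hab; exists (Node i (l ++ a :: r)).
    rewrite inE mem_cat; apply/or3P/Or32/splitsP; exists l, a, r.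
    split; rewrite ?mem_head //; apply/andP; split.
      apply/hasPn => d Hd; rewrite -leqNgt.
      apply/ltnW/(leq_trans Hab)/beta_le.
      rewrite labelsE inE; apply/orP/or_intror/flatten_mapP.
      by exists d; rewrite ?beta_mem.
    by apply/ltnW/(leq_trans Hab)/beta_le; rewrite labelsE mem_head.
  - move/negbT: Hab; rewrite -leqNgt; case: a => i r Hab.
    exists (Node i (l ++ b :: r)).
    rewrite inE mem_cat; apply/or3P/Or32/splitsP; exists l, b, r.
    split; rewrite ?inE ?eqxx ?orbT //; apply/andP; split.
      apply/hasPn => d Hd; rewrite -leqNgt.
      apply/(leq_trans Hab)/beta_le.
      rewrite labelsE inE; apply/orP/or_intror/flatten_mapP.
      by exists d; rewrite ?beta_mem.
    by apply/(leq_trans Hab)/beta_le; rewrite labelsE mem_head.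
rewrite labelsE inE eq_sym (negPf vM) /= => /flatten_mapP[c Hc HM].
have {IH} := IH c Hc HM; case/splitPr: Hc => s1 s2 IH.
have {IH} : c = Node M [::] \/ exists T0, c \in outer M T0.
  case: ifP IH => // _ [T0 HT0]; right; exists T0.
  by rewrite inE mem_cat HT0 !orbT.
case=> [->|[T0 HT0]].
  exists (Node v (s1 ++ s2)); rewrite innerE map_f // mem_cat.
  by apply/orP/or_introl/insertionsP; exists s1, s2.
exists (Node v (s1 ++ T0 :: s2)); rewrite innerE map_f // mem_cat.
by apply/orP/or_intror/replacementsP; exists s1, T0, c, s2.
Qed.

(* The children lists [::], [:: c] and l ++ [:: a; b] of M tell which kind of
   insertion created it. *)
Definition contraction (cs : seq ptree) : seq ptree :=
  match rev cs with
  | b :: a :: l =>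
    [:: if (beta a < beta b)%N then Node (label b) (rev l ++ a :: children b)
        else Node (label a) (rev l ++ b :: children a)]
  | _ => cs
  end.

(** The result is a list because deleting a leaf [M] leaves no tree; the flattening closes the
    gap. *)
Fixpoint removal (M : nat) (T : ptree) : seq ptree :=
  let: Node v cs := T in
  if v == M then contraction cs
  else [:: Node v (flatten (map (removal M) cs))].

Lemma contraction_cat l a b : contraction (l ++ [:: a; b]) =
  [:: if (beta a < beta b)%N then Node (label b) (l ++ a :: children b)
      else Node (label a) (l ++ b :: children a)].
Proof. by rewrite /contraction rev_cat /= revK. Qed.

Lemma removal_id M T : M \notin labels T -> removal M T = [:: T].
Proof.
elim/ptree_induction: T => v cs IH.
rewrite labelsE inE negb_or eq_sym => /andP[/negPf /= -> HM].
congr [:: Node v _].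
elim: cs IH HM => //= c cs IHcs IH.
rewrite forest_labels_cons mem_cat negb_or => /andP[Hc Hcs].
rewrite IH ?mem_head //= IHcs // => d Hd.
by apply: IH; rewrite inE Hd orbT.
Qed.

Lemma removal_forest_id M cs :
  M \notin forest_labels cs -> flatten (map (removal M) cs) = cs.
Proof.
elim: cs => //= c cs IHcs.
rewrite forest_labels_cons mem_cat negb_or => /andP[Hc Hcs].
by rewrite removal_id // IHcs.
Qed.

Lemma removal_splits M i cs T : uniq (labels (Node i cs)) ->
  T \in splits M i [::] cs -> removal M T = [:: Node i cs].
Proof.
move=> Hu /splitsP[l [j [r [Ecs Hj]]]].
(* This decides the test in [contraction] for both orders of [j] and [Node i r]. *)
have Hlt : (beta j < beta (Node i r))%N.
  apply: improper_edge_lt Hj; move: Hu; rewrite Ecs !labelsE forest_labels_cat.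
  by rewrite /= mem_cat cat_uniq negb_or => /andP[/andP[_ ->] /and3P[_ _ ->]].
rewrite !inE cat0s => /orP[] /eqP->; rewrite [LHS]/= eqxx contraction_cat.
  by rewrite Hlt Ecs.
by rewrite ltnNge ltnW // Ecs.
Qed.

Lemma removal_inner M T T' : M \notin labels T -> uniq (labels T) ->
  T' \in inner M T -> removal M T' = [:: T].
Proof.
elim/ptree_induction: T T' => v cs IH T'.
rewrite innerE labelsE inE negb_or eq_sym /= => /andP[vM HM] /andP[_ Hu].
move=> /mapP[ds Hds ->]; rewrite /= (negPf vM); congr [:: Node v _].
move: Hds; rewrite mem_cat => /orP[].
  move=> /insertionsP[s1 [s2 [Ecs ->]]].
  move: HM; rewrite Ecs forest_labels_cat mem_cat negb_or => /andP[H1 H2].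
  by rewrite map_cat flatten_cat /= eqxx !removal_forest_id.
move=> /replacementsP[s1 [c [d [s2 [Ecs Hd ->]]]]].
have Hc : c \in cs by rewrite Ecs mem_cat mem_head orbT.
move: HM Hu.
rewrite Ecs forest_labels_cat forest_labels_cons !mem_cat !negb_or !cat_uniq.
move=> /and3P[H1 Hcl H2] /and3P[_ _ /andP[Hu _]].
rewrite map_cat flatten_cat /= !removal_forest_id //.
suff -> : removal M d = [:: c] by [].
move: Hd; rewrite inE mem_cat => /or3P[/eqP->||].
- by rewrite /= eqxx.
- by case: c Hu {Hcl Hc Ecs} => i r Hu; apply: removal_splits.
- exact: IH.
Qed.

(** * Distinctness of the listed insertions *)

Lemma insertions_uniq (A : eqType) (x : A) s :
  x \notin s -> uniq (insertions x s).
Proof.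
elim: s => //= a s IHs; rewrite inE negb_or => /andP[xa xs].
rewrite map_inj_uniq ?IHs ?andbT // => [|u w []//].
by apply/mapP => -[r _ [E _]]; rewrite E eqxx in xa.
Qed.

Lemma replacements_uniq (A : eqType) (f : A -> seq A) s :
  {in s, forall a, a \notin f a /\ uniq (f a)} -> uniq (replacements f s).
Proof.
elim: s => //= a s IHs Hf; rewrite cat_uniq.
have [aa fa] := Hf a (mem_head _ _).
rewrite !map_inj_uniq ?fa ?IHs ?andbT => [|b Hb|u w []//|u w []//] /=.
  by apply/hasPn => r /mapP[q _ ->]; apply/mapP => -[b Hb [E _]]; move: aa; rewrite {1}E Hb.
by apply: Hf; rewrite inE Hb orbT.
Qed.

Lemma splits_size M i l cs T :
  T \in splits M i l cs -> (size l + 2 <= size (children T))%N.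
Proof.
move=> /splitsP[l' [j [r [_ _]]]].
by rewrite !inE => /orP[] /eqP->; rewrite /= !size_cat /=; lia.
Qed.

Lemma splits_label M i l cs T : T \in splits M i l cs -> label T = M.
Proof.
by move=> /splitsP[l' [j [r [_ _]]]]; rewrite !inE => /orP[] /eqP->.
Qed.

(** Edges further to the right give [M] more children; the two trees of one edge differ because [i]
    is not a label of [j]. *)
Lemma splits_uniq M i l cs :
  i \notin forest_labels cs -> uniq (splits M i l cs).
Proof.
elim: cs l => //= j r IHr l.
rewrite forest_labels_cons mem_cat negb_or cat_uniq => /andP[Hj Hr].
rewrite IHr // andbT; case: ifP => _ //=; last by rewrite has_pred0.
rewrite inE andbT; apply/andP; split.
  apply: contra Hj => /eqP[] /eqP; rewrite eqseq_cat // eqxx /=.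
  by move=> /eqP[-> _]; rewrite labelsE mem_head.
apply/hasPn => T /splits_size; rewrite size_rcons => HT.
by rewrite !inE; apply/norP; split; apply: contraTneq HT => ->;
  rewrite /= size_cat /= -ltnNge; lia.
Qed.

Lemma inner_uniq M T :
  M \notin labels T -> uniq (labels T) -> uniq (inner M T).
Proof.
elim/ptree_induction: T => v cs IH.
rewrite innerE labelsE inE negb_or => /andP[_ HM] Hu.
rewrite map_inj_uniq => [|u w []//]; rewrite cat_uniq; apply/and3P; split.
- apply: insertions_uniq; apply: contra HM => Hc.
  by apply/flatten_mapP; exists (Node M [::]); rewrite ?mem_head.
(* An insertion adds a child at [v], a replacement does not. *)
- apply/hasPn => ds /replacementsP[s1 [a [b [s2 [-> _ ->]]]]].
  apply/insertionsP => -[r1 [r2 [/(congr1 size) E /(congr1 size)]]].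
  by move: E; rewrite !size_cat /=; lia.
- apply: replacements_uniq => c Hc.
  have Mc : M \notin labels c.
    by apply: contra HM => Mc; apply/flatten_mapP; exists c.
  have cu : uniq (labels c) := child_labels_uniq Hc Hu.
  split.
    apply/negP => /outer_labels/perm_mem/(_ M).
    by rewrite mem_head (negPf Mc).
  (* In [Node M [:: c]] the root has one child, in [splits] at least two; [inner] keeps the root
     label of [c], which is not [M]. *)
  rewrite /= mem_cat negb_or cat_uniq IH // andbT -andbA; apply/and4P; split.
  - by apply/negP => /splits_size.
  - apply/negP => /inner_label E; rewrite /= in E.
    by case: c E Mc {Hc cu} => w r /= <-; rewrite mem_head.
  - by case: c cu {Hc Mc} => w r /= /andP[+ _]; apply: splits_uniq.
  - apply/hasPn => T /inner_label E; apply/negP => /splits_label E'.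
    by move: E Mc; rewrite E'; case: c {Hc cu} => w r /= <-; rewrite mem_head.
Qed.

(** * Enumeration of the trees on [m] with root 1 *)

Fixpoint plane_trees (m : nat) : seq ptree :=
  if m is m'.+1 then
    if m' is 0 then [:: Node 1 [::]]
    else flatten [seq inner m T | T <- plane_trees m']
  else [::].

Lemma plane_treesS m :
  plane_trees m.+2 = flatten [seq inner m.+2 T | T <- plane_trees m.+1].
Proof. by []. Qed.

Lemma mem_plane_trees m T : (T \in plane_trees m.+1) =
  (label T == 1%N) && perm_eq (labels T) (iota 1 m.+1).
Proof.
elim: m T => [|m IHm] T.
  rewrite inE; apply/eqP/andP => [->//|[]]; case: T => v cs /= /eqP->.
  rewrite perm_cons => /perm_size /=.
  by case: cs => // -[w r] cs.
have Eiota : perm_eq (iota 1 m.+2) (m.+2 :: iota 1 m.+1).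
  by rewrite -[m.+2]addn1 iotaD addn1 perm_catC /= add1n.
rewrite plane_treesS; apply/flatten_mapP/andP.
  move=> [T0]; rewrite IHm => /andP[/eqP L0 P0] HT.
  rewrite (inner_label HT) L0; split=> //.
  apply: perm_trans (inner_labels HT) _.
  by rewrite perm_sym (perm_trans Eiota) // perm_cons perm_sym.
move=> [/eqP LT PT].
have : m.+2 \in labels T by rewrite (perm_mem PT) mem_iota; lia.
move=> /insertion_exists; rewrite LT /= => -[T0 HT0]; exists T0 => //.
rewrite IHm -(inner_label HT0) LT eqxx /= -(perm_cons m.+2).
by rewrite -(permPl (inner_labels HT0)) (permPl PT).
Qed.

Lemma plane_trees_labels m T : T \in plane_trees m ->
  [/\ uniq (labels T), size (labels T) = m
    & {in labels T, forall a, 1 <= a <= m}%N].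
Proof.
case: m => // m; rewrite mem_plane_trees => /andP[_ P]; split.
- by rewrite (perm_uniq P) iota_uniq.
- by rewrite (perm_size P) size_iota.
- by move=> a; rewrite (perm_mem P) mem_iota add1n ltnS.
Qed.

(** Blocks of distinct [a] are disjoint since [g] recovers [a]; one-element lists fit the type of
    [removal]. *)
Lemma flatten_map_uniq (A B : eqType) (f : A -> seq B) (g : B -> seq A) s :
  uniq s -> {in s, forall a, uniq (f a)} ->
  {in s, forall a, {in f a, forall b, g b = [:: a]}} ->
  uniq (flatten (map f s)).
Proof.
elim: s => //= a s IHs /andP[as_ us] Hf Hg.
rewrite cat_uniq Hf ?mem_head //= IHs // => [|b Hb|b Hb]; first last.
- by apply: Hg; rewrite inE Hb orbT.
- by apply: Hf; rewrite inE Hb orbT.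
rewrite andbT; apply/hasPn => y /flatten_mapP[b Hb Hy].
apply: contra as_ => Hya.
have := Hg a (mem_head _ _) y Hya; rewrite (Hg b) // ?inE ?Hb ?orbT //.
by case=> <-.
Qed.

Lemma plane_trees_uniq m : uniq (plane_trees m).
Proof.
case: m => //; elim=> // m IHm; rewrite plane_treesS.
have HM T : T \in plane_trees m.+1 -> m.+2 \notin labels T.
  move=> /plane_trees_labels[_ _ Hle]; apply/negP => /Hle.
  by rewrite ltnn andbF.
apply: (@flatten_map_uniq _ _ _ (removal m.+2)) => // T HT.
  by apply: inner_uniq (HM T HT) _; have [] := plane_trees_labels HT.
move=> T' HT'; apply: removal_inner (HM T HT) _ HT'.
by have [] := plane_trees_labels HT.
Qed.

Arguments plane_trees : simpl never.

(** * Weights and their sums over insertions *)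

Definition improper_children (v : nat) (cs : seq ptree) : nat :=
  count id [seq ~~ (e.1 || (v < beta e.2)%N) | e <- zip (elders cs) cs].

Lemma improperE v cs :
  improper (Node v cs) = (improper_children v cs + sumn (map improper cs))%N.
Proof. by []. Qed.

Lemma improper_children_cons v c cs : improper_children v (c :: cs) =
  (improper_edge v c cs + improper_children v cs)%N.
Proof. by rewrite /improper_children /= negb_or -leqNgt. Qed.

Section TreeWeight.
Variables (R : comNzRingType) (t y : R).

(** The status of the edges at [v] depends only on the minima [bs] of the child subtrees, which
    turns the sums below into facts on lists of numbers. *)
Fixpoint edges_weight (x : R) (v : nat) (bs : seq nat) : R :=
  if bs is b :: bs' then
    (if has (fun d => (d < b)%N) bs' then t
     else x * (if (v < b)%N then 1 else y)) * edges_weight x v bs'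
  else 1.

Fixpoint tree_weight (x : R) (T : ptree) : R :=
  let: Node v cs := T in
  edges_weight x v (map beta cs) * \prod_(w <- map (tree_weight 1) cs) w.

Lemma tree_weightE x v cs : tree_weight x (Node v cs) =
  edges_weight x v (map beta cs) * \prod_(c <- cs) tree_weight 1 c.
Proof. by rewrite /= big_map. Qed.

Lemma count_elders_le cs : (count id (elders cs) <= size cs)%N.
Proof. by elim: cs => //= c cs; case: (has _ _) => /=; lia. Qed.

Lemma edges_weight_exp x v cs : edges_weight x v (map beta cs) =
  x ^+ (size cs - count id (elders cs)) * t ^+ count id (elders cs)
    * y ^+ improper_children v cs.
Proof.
elim: cs => [|c cs IHcs]; first by rewrite /= !expr0 !mulr1.
rewrite improper_children_cons /= {}IHcs /improper_edge has_map.
have := count_elders_le cs; move: (count _ _) (improper_children _ _) => e i He.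
rewrite /preim /=; case: ifP => _ /=.
  by rewrite !add1n add0n subSS exprS; ring.
rewrite ?add0n subSn // exprS [(beta c <= v)%N]leqNgt; case: ltnP => _ /=.
  by rewrite ?add0n; ring.
by rewrite add1n exprS; ring.
Qed.

Lemma tree_weight_exp x T :
  tree_weight x T = x ^+ young_root T * t ^+ eld T * y ^+ improper T.
Proof.
elim/ptree_induction: T x => v cs IH x.
rewrite tree_weightE edges_weight_exp improperE /young_root /deg_root /eld_root.
suff -> : \prod_(c <- cs) tree_weight 1 c =
    t ^+ sumn (map eld cs) * y ^+ sumn (map improper cs).
  by rewrite /= !exprD; ring.
elim: cs IH => [|c cs IHcs] IH; first by rewrite big_nil /= !expr0 mulr1.
rewrite big_cons IHcs => [|d Hd]; last by apply: IH; rewrite inE Hd orbT.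
by rewrite IH ?mem_head // expr1n /= !exprD; ring.
Qed.

(** A value above all of [bs] makes no other entry elder, so only its own factor is new: [x] in last
    position, [t] elsewhere. *)
Lemma sum_insertions_edges x v M bs : (v < M)%N ->
  {in bs, forall b, (b < M)%N} ->
  \sum_(ds <- insertions M bs) edges_weight x v ds
    = edges_weight x v bs * (x + (size bs)%:R * t).
Proof.
move=> vM; elim: bs => [|b bs IHbs] HM /=.
  by rewrite big_seq1 /= vM; ring.
have bM : (b < M)%N by apply: HM; rewrite mem_head.
rewrite big_cons /= bM /= big_map big_seq.
under eq_bigr => ds Hds.
  rewrite /=; have -> : has (fun d => (d < b)%N) ds = has (fun d => (d < b)%N) bs.
    have /insertionsP[s1 [s2 [-> ->]]] := Hds.
    by rewrite !has_cat /= [(M < b)%N]ltnNge ltnW.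
  over.
rewrite -big_seq -mulr_sumr IHbs => [|d Hd]; last by apply: HM; rewrite inE Hd orbT.
by rewrite -natr1; ring.
Qed.

(** As [b] is minimal from its position on, [r] does not influence which entries of [l] are elder. A
    younger entry of [l] is at most [b], hence improper under [i] and under [M]. *)
Lemma edges_weight_cut x i M l b r : all (fun d => b <= d)%N r -> (b <= i <= M)%N ->
  edges_weight x i (l ++ b :: r)
    = edges_weight x M (rcons l b) * edges_weight x i r.
Proof.
move=> Hr /andP[bi iM]; elim: l => [|a l IHl] /=.
  rewrite !ltnNge bi (leq_trans bi iM) /= mulr1.
  suff -> : has (fun d => (d < b)%N) r = false by [].
  by apply/hasPn => d Hd; rewrite -leqNgt (allP Hr).
rewrite {}IHl mulrA; congr (_ * _ * _); rewrite has_cat has_rcons /=.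
case Hba: (b < a)%N; rewrite /= ?orbT //.
have ab : (a <= b)%N by rewrite leqNgt Hba.
have -> : has (fun d => (d < a)%N) r = false.
  by apply/hasPn => d Hd; rewrite -leqNgt (leq_trans ab) ?(allP Hr).
rewrite orbF !ltnNge (leq_trans ab bi).
by rewrite (leq_trans ab (leq_trans bi iM)).
Qed.

Lemma edges_weight_elder x M l a b : (b < a)%N ->
  edges_weight x M (l ++ [:: a; b]) = t * edges_weight x M (rcons l b).
Proof.
move=> ba; elim: l => [|c l IHl] /=; first by rewrite ba.
rewrite {}IHl mulrCA; congr (_ * (_ * _)); rewrite has_cat has_rcons /= orbF.
case bc: (b < c)%N; rewrite /= ?orbT //.
by rewrite orbF ltnNge (leq_trans _ (ltnW ba)) ?orbF // leqNgt bc.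
Qed.

(** Moving the children up to [j] from [i] to [M] preserves their weight; the new edge to [Node i r]
    has factor [y] after [j] and [t] before it. *)
Lemma sum_splits M i l cs : uniq (labels (Node i (l ++ cs))) ->
  {in labels (Node i (l ++ cs)), forall a, (a < M)%N} ->
  \sum_(T <- splits M i l cs) tree_weight 1 T
    = tree_weight 1 (Node i (l ++ cs)) * ((improper_children i cs)%:R * (t + y)).
Proof.
elim: cs l => [|j r IHr] l Hu HM; first by rewrite big_nil mul0r mulr0.
rewrite improper_children_cons big_cat IHr ?cat_rcons // natrD.
case: ifP => Hj; last by rewrite big_nil /= mulr0n !add0r.
rewrite mulrDl mulrDr; congr (_ + _); rewrite mul1r.
have Hlt : (beta j < beta (Node i r))%N.
  apply: improper_edge_lt Hj; move: Hu; rewrite !labelsE forest_labels_cat.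
  by rewrite /= mem_cat cat_uniq negb_or => /andP[/andP[_ ->] /and3P[_ _ ->]].
have iM : (i < M)%N by apply: HM; rewrite labelsE mem_head.
have bM : (beta (Node i r) <= M)%N.
  by apply: leq_trans (ltnW iM); apply: beta_le; rewrite labelsE mem_head.
have /andP[Hr ji] := Hj.
have Hall : all (fun d => beta j <= d)%N (map beta r).
  by apply/allP => _ /mapP[d Hd ->]; rewrite leqNgt; exact: (hasPn Hr).
(* Naming the tree [N] keeps simplification from unfolding its minimum and weight. *)
have := tree_weightE 1 i r; move: (Node i r) Hlt bM => N Hlt bM EN.
rewrite big_cons big_seq1 !tree_weightE !map_cat !big_cat !big_cons !big_nil /=.
rewrite (edges_weight_elder _ _ _ Hlt) EN.
have jM := leq_trans ji (ltnW iM).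
have -> : edges_weight 1 i (map beta l ++ beta j :: map beta r) =
    edges_weight 1 M (rcons (map beta l) (beta j)) * edges_weight 1 i (map beta r).
  by apply: edges_weight_cut; rewrite // ji ltnW.
have -> : edges_weight 1 M (map beta l ++ [:: beta j; beta N]) =
    edges_weight 1 M (rcons (map beta l) (beta j)) * edges_weight 1 M [:: beta N].
  by apply: edges_weight_cut; [rewrite /= andbT; exact: ltnW | rewrite jM leqnn].
rewrite /= [(M < _)%N]ltnNge bM /=.
ring.
Qed.

(** A Leibniz rule: the edges at [v] keep their weight, and one factor of the product over children
    changes at a time. *)
Lemma sum_replacements (f : ptree -> seq ptree) (k : ptree -> R) x v cs :
  {in cs, forall c, {in f c, forall d, beta d = beta c}} ->
  {in cs, forall c, \sum_(d <- f c) tree_weight 1 d = tree_weight 1 c * k c} ->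
  \sum_(ds <- replacements f cs) tree_weight x (Node v ds)
    = tree_weight x (Node v cs) * \sum_(c <- cs) k c.
Proof.
move=> Hb Hk; rewrite tree_weightE.
have -> : \sum_(ds <- replacements f cs) tree_weight x (Node v ds) =
    edges_weight x v (map beta cs) *
    \sum_(ds <- replacements f cs) \prod_(d <- ds) tree_weight 1 d.
  rewrite mulr_sumr big_seq [RHS]big_seq; apply: eq_bigr => ds.
  move=> /replacementsP[s1 [c [d [s2 [Ecs Hd ->]]]]].
  rewrite tree_weightE Ecs !map_cat /= (Hb c) //.
  by rewrite Ecs mem_cat mem_head orbT.
rewrite -mulrA; congr (_ * _).
elim: cs Hb Hk => [|c cs IHcs] Hb Hk; first by rewrite !big_nil mulr0.
rewrite /= big_cat !big_map !big_cons /=.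
under eq_bigr do rewrite big_cons.
under [X in _ + X = _]eq_bigr do rewrite big_cons.
rewrite -mulr_suml -mulr_sumr Hk ?mem_head // IHcs /=; first by ring.
  by move=> d Hd; apply: Hb; rewrite inE Hd orbT.
by move=> d Hd; apply: Hk; rewrite inE Hd orbT.
Qed.

(** With [N] edges, leaves give [x + N(1 + t)] and subdivisions [N y]. Improper edges at the root
    are left out, as using them would replace the root by [M]. *)
Lemma sum_inner M T x : uniq (labels T) -> {in labels T, forall a, (a < M)%N} ->
  \sum_(T' <- inner M T) tree_weight x T'
    = tree_weight x T * (x + (size (labels T)).-1%:R * (1 + t + y)
        + (sumn (map improper (children T)))%:R * (t + y)).
Proof.
elim/ptree_induction: T x => v cs IH x Hu HM.
have vM : (v < M)%N by apply: HM; rewrite labelsE mem_head.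
have HMc c : c \in cs -> {in labels c, forall a, (a < M)%N}.
  by move=> Hc a Ha; apply/HM/(child_labels _ Hc).
rewrite innerE big_map big_cat /=.
have -> : \sum_(ds <- insertions (Node M [::]) cs) tree_weight x (Node v ds) =
    tree_weight x (Node v cs) * (x + (size cs)%:R * t).
  rewrite tree_weightE mulrAC -(size_map beta) -(sum_insertions_edges _ vM); last first.
    by move=> _ /mapP[c Hc ->]; apply/(HMc c Hc)/beta_mem.
  have -> : insertions M (map beta cs) = map (map beta) (insertions (Node M [::]) cs).
    by elim: (cs) => //= c s ->; rewrite -!map_comp.
  rewrite big_map mulr_suml big_seq [RHS]big_seq; apply: eq_bigr => ds.
  move=> /insertionsP[s1 [s2 [-> ->]]]; rewrite tree_weightE !big_cat big_cons.
  by rewrite [tree_weight 1 (Node M _)]tree_weightE /= big_nil !mul1r.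
(* The first [y] comes from [Node M [:: c]]; [splits] and [inner] at [x = 1] together account for
   all improper edges of [c]. *)
rewrite (@sum_replacements _ (fun c => y + (size (labels c))%:R
   + (size (labels c)).-1%:R * (t + y) + (improper c)%:R * (t + y))) => [|c Hc d|c Hc].
- rewrite -mulrDr -!addrA; congr (_ * (_ + _)).
  rewrite /= -/(forest_labels cs).
  elim: (cs) => [|[w r] s IHs]; first by rewrite big_nil /= !mul0r.
  rewrite big_cons forest_labels_cons size_cat !natrD.
  (* The induction hypothesis is solved for its sum over [s]. *)
  move: IHs => /(canRL (addKr _)) ->.
  by rewrite /= -!natr1; ring.
- exact/outer_beta/HMc.
- rewrite big_cons big_cat IH //; [|exact: child_labels_uniq Hu|exact: HMc].
  have := HMc c Hc; case: c Hc (child_labels_uniq Hc Hu) => w r Hc cu Hw.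
  rewrite sum_splits // improperE natrD (tree_weightE 1 M) big_seq1 /=.
  have /Hw/ltnW := beta_mem (Node w r); rewrite leqNgt => /negPf /= ->.
  by rewrite -natr1; ring.
Qed.

End TreeWeight.

(** * Edges at the root *)

(** The last child is never elder; this makes the truncated subtraction in [weight] exact. *)
Lemma count_elders_lt cs : cs != [::] -> (count id (elders cs) < size cs)%N.
Proof.
elim: cs => // c [|d cs] IHcs _ //.
by have /= := IHcs isT; case: (_ || _); lia.
Qed.

Lemma improper_children0 v cs :
  {in cs, forall c, v < beta c}%N -> improper_children v cs = 0%N.
Proof.
elim: cs => //= c cs IHcs Hv.
rewrite improper_children_cons IHcs => [|d Hd]; last by apply: Hv; rewrite inE Hd orbT.
by rewrite /improper_edge leqNgt Hv ?mem_head // andbF.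
Qed.

(** The root 1 is below all other labels, so its edges are proper and [sum_inner] misses no improper
    edge. *)
Lemma improper_plane_tree m T : T \in plane_trees m ->
  improper T = sumn (map improper (children T)).
Proof.
move=> HT; have [Hu _ Hpos] := plane_trees_labels HT.
have : label T = 1%N by case: m HT {Hpos} => // m; rewrite mem_plane_trees => /andP[/eqP].
case: T Hu Hpos {HT} => v cs Hu Hpos /= Ev; rewrite -/(improper_children v cs).
rewrite improper_children0 // => c Hc.
have Hb := child_labels v Hc (beta_mem c).
have /andP[b1 _] := Hpos _ Hb; rewrite Ev ltn_neqAle b1 andbT.
apply: contraTneq Hu => E; rewrite labelsE /= negb_and negbK Ev E.
by apply/orP/or_introl/flatten_mapP; exists c; rewrite ?beta_mem.
Qed.

Lemma deriv_tree_weight (R : comNzRingType) (t x : R) T :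
  'X * (tree_weight t%:P 'X x%:P T)^`()
    = (improper T)%:R * tree_weight t%:P 'X x%:P T.
Proof.
rewrite tree_weight_exp -!polyC_exp -polyCM deriv_mulC derivXn.
case: (improper T) => [|k]; first by rewrite mulr0n !mulr0 mul0r.
by rewrite mulr_natl mulrCA mulrnAr -exprS mulrnAr.
Qed.

Lemma coef_tree_weight (R : comNzRingType) (t x : R) T k :
  (tree_weight t%:P 'X x%:P T)`_k
    = (x ^+ young_root T * t ^+ eld T) *+ (improper T == k).
Proof.
by rewrite tree_weight_exp -!polyC_exp -polyCM coefCM coefXn eq_sym mulr_natr.
Qed.

(** * The generating function and its recurrence *)

(** The polynomial variable is y. For [n >= 1] there is one factor [x] more than in [weight], since
    every younger child of the root counts. *)
Definition tree_sum (R : comNzRingType) (t x : R) (n : nat) : {poly R} :=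
  \sum_(T <- plane_trees n.+1) tree_weight t%:P 'X x%:P T.

Lemma tree_sumS (R : comNzRingType) (t x : R) n : tree_sum t x n.+1 =
  (x%:P + n%:R * (1 + t%:P + 'X)) * tree_sum t x n
    + (t%:P + 'X) * ('X * (tree_sum t x n)^`()).
Proof.
rewrite /tree_sum plane_treesS big_flatten big_map.
rewrite linear_sum !mulr_sumr -big_split.
rewrite big_seq [RHS]big_seq; apply: eq_bigr => T HT.
have [Hu Hs Hle] := plane_trees_labels HT.
rewrite sum_inner // => [|a /Hle/andP[_]]; last by rewrite ltnS.
rewrite -(improper_plane_tree HT) Hs deriv_tree_weight /=.
by ring.
Qed.

Lemma tree_sum1 (R : comNzRingType) (t x : R) : tree_sum t x 1 = x%:P.
Proof.
rewrite tree_sumS /tree_sum big_seq1 /= big_nil mulr1 derivC.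
by ring.
Qed.

Lemma Qz1S n : Qz1 n.+2 =
  (xv%:P + n.+1%:R * (1 + tv%:P + 'X)) * Qz1 n.+1 + (tv%:P + 'X) * ('X * (Qz1 n.+1)^`()).
Proof.
(* In this form evaluation at z = 1 is a ring morphism on coefficients and commutes with the
   derivation in y. *)
have Ez p : map_poly (fun q : {poly PXT} => q.[1]) p = map_poly (horner_eval 1) p.
  by [].
rewrite /Qz1 !Ez; rewrite [Q n.+2]/(Qstep n.+1 (Q n.+1)) /Qstep.
move: (Q n.+1) => p.
rewrite /X4 /Y4 /Z4 /T4 !(rmorphD, rmorphM, rmorph_nat) /= deriv_map.
rewrite !map_polyC map_polyX /= !horner_evalE !hornerC hornerX polyC1.
by ring.
Qed.

Lemma tree_sumE n : tree_sum tv xv n.+1 = xv%:P * Qz1 n.+1.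
Proof.
elim: n => [|n IHn].
  have -> : Qz1 1 = 1 by exact: (rmorph1 (map_poly (horner_eval 1))).
  by rewrite tree_sum1 mulr1.
rewrite tree_sumS IHn Qz1S deriv_mulC.
by ring.
Qed.

Lemma coef_tree_sum n k : (tree_sum tv xv n.+1)`_k =
  xv * \sum_(T <- plane_trees n.+2 | improper T == k) weight T.
Proof.
rewrite coef_sum mulr_sumr [RHS]big_mkcond big_seq [RHS]big_seq.
apply: eq_bigr => T HT.
rewrite coef_tree_weight; case: eqP => _; last by rewrite mulr0n.
rewrite mulr1n /weight mulrA -exprS; congr (_ ^+ _ * _).
(* At least two vertices exist, so the root has a younger child and the extra [xv] restores the full
   exponent. *)
have [_ Hs _] := plane_trees_labels HT.
case: T Hs {HT} => v [|c cs] // _.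
have /= := @count_elders_lt (c :: cs) isT.
by rewrite /young_root /deg_root /eld_root /=; lia.
Qed.

Theorem theorem2p1 (n k : nat) :
  (1 <= n)%N -> (k <= n - 1)%N ->
  (exists s, enumO n.+1 k s) /\
  (forall s, enumO n.+1 k s -> Qnk n k = \sum_(T <- s) weight T).
Proof.
case: n => // n _ _.
set s0 := [seq T <- plane_trees n.+2 | improper T == k].
have Hs0 : enumO n.+2 k s0.
  split; first by apply/List_NoDupP; rewrite filter_uniq ?plane_trees_uniq.
  move=> T; rewrite List_InP mem_filter mem_plane_trees; split.
    by move=> /andP[/eqP ? /andP[/eqP ? ?]].
  by move=> [-> -> ->]; rewrite !eqxx.
split; first by exists s0.
move=> s [us Hs].
have -> : \sum_(T <- s) weight T = \sum_(T <- s0) weight T.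
  apply: perm_big; apply: uniq_perm.
  - exact/List_NoDupP.
  - by case: Hs0 => /List_NoDupP.
  - move=> T; apply/idP/idP => /List_InP HT; apply/List_InP.
      by apply/Hs0.2/Hs.
    by apply/Hs/Hs0.2.
(* The surplus factor [xv] is cancelled in an integral domain. *)
have x0 : xv != 0 by rewrite polyX_eq0.
apply: (mulfI x0); rewrite big_filter -coef_tree_sum tree_sumE.
by rewrite coefCM.
Qed.
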